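(* Let $A,\tilde{A}\in\mathbb{R}^{n\times n}$ be nonsingular matrices, let $W\in\mathbb{R}^{n\times n}$ be a symmetric positive-definite matrix, and let $$A_p = (\tilde{A}^{-1}W\tilde{A}^{-T})(A^TW^{-1}A).$$ Let $E = A\tilde{A}^{-1}-I_n$. Then $$\sigma(A_p)\subset \mathcal{B}\Big(1,\,(1+\kappa_2(W))\|E\|_2+\kappa_2(W)\|E\|_2^2\Big).$$
   Context: $\|\cdot\|_2$ is the matrix norm induced by the Euclidean norm (spectral norm), $\kappa_2(W)=\|W\|_2\|W^{-1}\|_2$ is the condition number of $W$ in the Euclidean norm, $\sigma(M)$ is the spectrum (set of eigenvalues) of a matrix $M$, $\mathcal{B}(a,r)$ is the closed ball of radius $r$ centered at $a$, $I_n$ is the $n\times n$ identity matrix, and $\tilde{A}^{-T}=(\tilde{A}^{-1})^T$. *)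

(* Defs.v *)
From HB Require Import structures.
From mathcomp Require Import all_boot all_order all_algebra.
From mathcomp Require Import complex.
From mathcomp Require Import all_classical all_reals.
From mathcomp Require Import topology normedtype.

Set Implicit Arguments.
Unset Strict Implicit.
Unset Printing Implicit Defensive.

Import Order.TTheory GRing.Theory Num.Theory.
Import numFieldNormedType.Exports.

Local Open Scope classical_set_scope.
Local Open Scope ring_scope.

(* The library norm on matrices is the sup norm, hence a separate
   Euclidean norm. *)
Definition euclidean_norm (R : realType) (n : nat) (x : 'cV[R]_n) : R :=
  Num.sqrt (\sum_(i < n) x i 0 ^+ 2).

(* For [n = 0] this is [sup set0 = 0]. *)
Definition norm2 (R : realType) (n : nat) (M : 'M[R]_n) : R :=
  sup [set euclidean_norm (M *m x) / euclidean_norm x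
      | x in [set x : 'cV[R]_n | x != 0]].

Definition cond2 (R : realType) (n : nat) (M : 'M[R]_n) : R :=
  norm2 M * norm2 (invmx M).

Definition sym_posdef (R : realType) (n : nat) (W : 'M[R]_n) : Prop :=
  W^T = W /\ forall x : 'cV[R]_n, x != 0 -> 0 < (x^T *m W *m x) 0 0.

(* Complex eigenvalues. The library's [eigenvalue] uses row eigenvectors, which
   gives the same set as column eigenvectors. *)
Definition spectrum (R : realType) (n : nat) (M : 'M[R]_n) : set R[i] :=
  [set z | eigenvalue (map_mx (real_complex R) M) z].

(* The library's [closed_ball a r] is the closure of the open ball, which is
   empty when [r = 0]; [closed_ball_] is the set of [z] with [`|a - z| <= r]. *)
Definition cball (R : realType) (a : R[i]) (r : R) : set R[i] :=
  closed_ball_ (fun z : R[i] => `|z|) a (real_complex R r).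

(* Main.v *)
(* Conjugating [Ap] by [At] turns it into [W (I + E)^T W^-1 (I + E) = I + F]
   with [F = E + G + G E] and [G = W E^T W^-1]. The norms of [E] and [G] are at
   most [norm2 E] and [cond2 W * norm2 E], so [norm2 F], and hence every
   [|z - 1|] for [z] an eigenvalue of [Ap], is at most the stated radius. *)
Require Import Defs.
From HB Require Import structures.
From mathcomp Require Import all_boot all_order all_algebra.
From mathcomp Require Import complex.
From mathcomp Require Import all_classical all_reals.
From mathcomp Require Import ring lra.

Set Implicit Arguments.
Unset Strict Implicit.
Unset Printing Implicit Defensive.

Import Order.TTheory GRing.Theory Num.Theory.
Local Open Scope classical_set_scope.
Local Open Scope ring_scope.

Definition dot (R : realType) (n : nat) (x y : 'cV[R]_n) : R := (x^T *m y) 0 0.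

Lemma dotC (R : realType) (n : nat) (x y : 'cV[R]_n) : dot x y = dot y x.
Proof. by rewrite /dot -[y^T *m x]trmxK trmx_mul trmxK [RHS]mxE. Qed.

Lemma dotDl (R : realType) (n : nat) (x y z : 'cV[R]_n) :
  dot (x + y) z = dot x z + dot y z.
Proof. by rewrite /dot linearD mulmxDl mxE. Qed.

Lemma dotZl (R : realType) (n : nat) (a : R) (x y : 'cV[R]_n) :
  dot (a *: x) y = a * dot x y.
Proof. by rewrite /dot linearZ -scalemxAl mxE. Qed.

Lemma dotDr (R : realType) (n : nat) (x y z : 'cV[R]_n) :
  dot x (y + z) = dot x y + dot x z.
Proof. by rewrite !(dotC x) dotDl. Qed.

Lemma dotZr (R : realType) (n : nat) (a : R) (x y : 'cV[R]_n) :
  dot x (a *: y) = a * dot x y.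
Proof. by rewrite !(dotC x) dotZl. Qed.

Lemma dot_trmx (R : realType) (n : nat) (M : 'M[R]_n) (x y : 'cV[R]_n) :
  dot (M^T *m x) y = dot x (M *m y).
Proof. by rewrite /dot trmx_mul trmxK mulmxA. Qed.

Lemma dotxxE (R : realType) (n : nat) (x : 'cV[R]_n) :
  dot x x = \sum_(i < n) x i 0 ^+ 2.
Proof. by rewrite /dot mxE; apply: eq_bigr => i _; rewrite mxE expr2. Qed.

Lemma dotxx_ge0 (R : realType) (n : nat) (x : 'cV[R]_n) : 0 <= dot x x.
Proof. by rewrite dotxxE sumr_ge0 // => i _; exact: sqr_ge0. Qed.

Lemma dotxx_eq0 (R : realType) (n : nat) (x : 'cV[R]_n) :
  (dot x x == 0) = (x == 0).
Proof.
apply/eqP/eqP => [|->]; last by rewrite /dot mulmx0 mxE.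
rewrite dotxxE => /eqP.
rewrite psumr_eq0 => [/allP x0|i _]; last exact: sqr_ge0.
apply/colP => i; rewrite mxE; apply/eqP.
by rewrite -sqrf_eq0; apply: x0; rewrite mem_index_enum.
Qed.

Lemma euclidean_norm_ge0 (R : realType) (n : nat) (x : 'cV[R]_n) :
  0 <= euclidean_norm x.
Proof. exact: sqrtr_ge0. Qed.

Lemma sqr_euclidean_norm (R : realType) (n : nat) (x : 'cV[R]_n) :
  euclidean_norm x ^+ 2 = dot x x.
Proof. by rewrite /euclidean_norm -dotxxE sqr_sqrtr // dotxx_ge0. Qed.

Lemma euclidean_norm_gt0 (R : realType) (n : nat) (x : 'cV[R]_n) :
  (0 < euclidean_norm x) = (x != 0).
Proof.
by rewrite lt_neqAle euclidean_norm_ge0 andbT eq_sym -sqrf_eq0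
  sqr_euclidean_norm dotxx_eq0.
Qed.

Lemma euclidean_norm0 (R : realType) (n : nat) :
  euclidean_norm (0 : 'cV[R]_n) = 0.
Proof.
by apply/eqP; rewrite -sqrf_eq0 sqr_euclidean_norm dotxx_eq0.
Qed.

Lemma cauchy_schwarz (R : realType) (n : nat) (x y : 'cV[R]_n) :
  `|dot x y| <= euclidean_norm x * euclidean_norm y.
Proof.
have [->|y0] := eqVneq y 0; first by rewrite /dot mulmx0 mxE normr0 euclidean_norm0 mulr0.
rewrite -ler_sqr ?nnegrE ?mulr_ge0 ?euclidean_norm_ge0 //.
rewrite real_normK ?num_real // exprMn !sqr_euclidean_norm.
have yy : 0 < dot y y by rewrite lt_neqAle eq_sym dotxx_eq0 y0 dotxx_ge0.
(* This squared norm equals [dot y y * (dot x x * dot y y - dot x y ^+ 2)]; the positive factor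
   [dot y y] is then cancelled. *)
have := dotxx_ge0 (dot y y *: x + (- dot x y) *: y).
rewrite !(dotDl, dotDr, dotZl, dotZr) (dotC y x) => h.
rewrite -subr_ge0 -(pmulr_rge0 _ yy).
by move: h; congr (0 <= _); ring.
Qed.

Lemma euclidean_normD (R : realType) (n : nat) (x y : 'cV[R]_n) :
  euclidean_norm (x + y) <= euclidean_norm x + euclidean_norm y.
Proof.
rewrite -ler_sqr ?nnegrE ?addr_ge0 ?euclidean_norm_ge0 //.
rewrite sqrrD !sqr_euclidean_norm !(dotDl, dotDr) (dotC y x).
have := le_trans (ler_norm _) (cauchy_schwarz x y); lra.
Qed.

(** Boundedness is what makes the [sup] in [norm2] a genuine upper bound. It comes from
    Cauchy-Schwarz applied to each row of [M]. *)
Lemma norm2_has_ubound (R : realType) (n : nat) (M : 'M[R]_n) :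
  has_ubound [set euclidean_norm (M *m x) / euclidean_norm x
             | x in [set x : 'cV[R]_n | x != 0]].
Proof.
(* With [F] the squared Frobenius norm, [F + 1] serves as the bound: [F <= (F + 1) ^+ 2] avoids a
   square root. *)
exists (\sum_i euclidean_norm (row i M)^T ^+ 2 + 1) => _ [x x0 <-].
set F := \sum_i _.
have F0 : 0 <= F by apply: sumr_ge0 => i _; exact: sqr_ge0.
rewrite ler_pdivrMr ?euclidean_norm_gt0 //.
rewrite -ler_sqr ?nnegrE ?mulr_ge0 ?addr_ge0 ?euclidean_norm_ge0 //.
apply: (@le_trans _ _ (F * euclidean_norm x ^+ 2)).
  rewrite [leLHS]sqr_euclidean_norm [leLHS]dotxxE [leRHS]mulr_suml.
  apply: ler_sum => i _.
  have -> : (M *m x) i 0 = dot (row i M)^T x.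
    by rewrite /dot trmxK -row_mul [RHS]mxE.
  rewrite -exprMn -[leLHS]real_normK ?num_real //.
  by rewrite ler_sqr ?nnegrE ?mulr_ge0 ?euclidean_norm_ge0 // cauchy_schwarz.
rewrite exprMn ler_wpM2r ?sqr_ge0 //; nra.
Qed.

Lemma norm2_ge0 (R : realType) (n : nat) (M : 'M[R]_n) : 0 <= norm2 M.
Proof.
rewrite /norm2; set S := (X in sup X).
have [[y Sy]|] := pselect (S !=set0); last first.
  by move/set0P/negP; rewrite negbK => /eqP ->; rewrite sup0.
apply: (le_trans _ (ub_le_sup (@norm2_has_ubound R n M) Sy)).
by case: Sy => x _ <-; rewrite divr_ge0 ?euclidean_norm_ge0.
Qed.

Lemma euclidean_norm_mulmx (R : realType) (n : nat) (M : 'M[R]_n)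
    (x : 'cV[R]_n) :
  euclidean_norm (M *m x) <= norm2 M * euclidean_norm x.
Proof.
have [->|x0] := eqVneq x 0; first by rewrite mulmx0 euclidean_norm0 mulr0.
rewrite -ler_pdivrMr ?euclidean_norm_gt0 //.
by apply: (ub_le_sup (@norm2_has_ubound R n M)); exists x.
Qed.

(** By Cauchy-Schwarz, [|M^T x|^2 = dot x (M M^T x) <= |x| * norm2 M * |M^T x|]; dividing by
    [|M^T x|] gives the bound. *)
Lemma euclidean_norm_mul_trmx (R : realType) (n : nat) (M : 'M[R]_n)
    (x : 'cV[R]_n) :
  euclidean_norm (M^T *m x) <= norm2 M * euclidean_norm x.
Proof.
have [->|y0] := eqVneq (M^T *m x) 0.
  by rewrite euclidean_norm0 mulr_ge0 ?norm2_ge0 ?euclidean_norm_ge0.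
rewrite -(@ler_pM2r _ (euclidean_norm (M^T *m x))) ?euclidean_norm_gt0 //.
rewrite -expr2 sqr_euclidean_norm dot_trmx.
apply: le_trans (ler_norm _) (le_trans (cauchy_schwarz _ _) _).
rewrite [norm2 M * _]mulrC -mulrA.
by rewrite ler_wpM2l ?euclidean_norm_ge0 // euclidean_norm_mulmx.
Qed.

Lemma sym_posdef_unitmx (R : realType) (n : nat) (W : 'M[R]_n) :
  sym_posdef W -> W \in unitmx.
Proof.
move=> [_ Wpos]; rewrite -row_free_unit -kermx_eq0.
apply/negPn/negP => /rowV0Pn [v /sub_kermxP vW v0].
have := Wpos v^T; rewrite trmxK vW mul0mx mxE ltxx.
by rewrite trmx_eq0 v0 => /(_ isT).
Qed.

(* A complex row eigenvector with transpose [x + iy] satisfies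
   [F^T x = a x - b y] and [F^T y = b x + a y] for [mu = a + ib]; summing the
   squared norms gives [|mu|^2 (|x|^2 + |y|^2)], so that bounding [F^T] on real
   vectors is enough. *)
Lemma eigenvalue_norm_le (R : realType) (n : nat) (F : 'M[R]_n) (r : R)
    (v : 'rV[R[i]]_n) (mu : R[i]) :
  0 <= r ->
  (forall x, euclidean_norm (F^T *m x) <= r * euclidean_norm x) ->
  v != 0 -> v *m map_mx (real_complex R) F = mu *: v ->
  `|mu| <= real_complex R r.
Proof.
move=> r0 Fr v0 vF.
pose x := (map_mx (@complex.Re R) v)^T; pose y := (map_mx (@complex.Im R) v)^T.
case: mu vF => a b vF.
have Fx : F^T *m x = a *: x + (- b) *: y.
  apply/colP => j; have /rowP/(_ j)/(congr1 (@complex.Re R)) := vF.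
  rewrite !mxE raddf_sum /=; case: (v 0 j) => p q /= e.
  rewrite mulNr -e; apply: eq_bigr => i _; rewrite !mxE /=.
  by case: (v 0 i) => ? ? /=; ring.
have Fy : F^T *m y = b *: x + a *: y.
  apply/colP => j; have /rowP/(_ j)/(congr1 (@complex.Im R)) := vF.
  rewrite !mxE raddf_sum /=; case: (v 0 j) => p q /= e.
  rewrite addrC -e; apply: eq_bigr => i _; rewrite !mxE /=.
  by case: (v 0 i) => ? ? /=; ring.
have xy : 0 < dot x x + dot y y.
  rewrite lt_neqAle addr_ge0 ?dotxx_ge0 // andbT eq_sym.
  rewrite paddr_eq0 ?dotxx_ge0 // !dotxx_eq0; apply: contra v0.
  move=> /andP[/eqP/colP x0 /eqP/colP y0]; apply/eqP/rowP => j.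
  move: (x0 j) (y0 j); rewrite !mxE.
  by case: (v 0 j) => p q /= -> ->.
have FrS u : dot (F^T *m u) (F^T *m u) <= r ^+ 2 * dot u u.
  rewrite -!sqr_euclidean_norm -exprMn.
  by rewrite ler_sqr ?nnegrE ?mulr_ge0 ?euclidean_norm_ge0 // Fr.
rewrite normc_def lecR /= -(ger0_norm r0) -sqrtr_sqr ler_sqrt ?sqr_ge0 //.
rewrite -(ler_pM2r xy) [leRHS]mulrDr.
apply: le_trans (lerD (FrS x) (FrS y)).
(* The cross terms [2ab * dot x y] occur with opposite signs and cancel, so the two sides are
   equal. *)
rewrite Fx Fy !(dotDl, dotDr, dotZl, dotZr) (dotC y x).
by rewrite le_eqVlt; apply/orP; left; apply/eqP; ring.
Qed.

(** Once the factors [B] and [B^T] cancel against their inverses, [W (1 + E)^T W^-1 (1 + E) = (1 +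
    G) (1 + E)] remains. The similarity is stated with [invmx B] on the right of both sides so that
    it carries a row eigenvector [v] to [v *m invmx B]. *)
Lemma preconditioned_mulmx_inv (K : comUnitRingType) (n : nat)
    (B W E : 'M[K]_n) (A := (1%:M + E) *m B) (G := W *m E^T *m invmx W) :
  B \in unitmx -> W \in unitmx ->
  (invmx B *m W *m (invmx B)^T) *m (A^T *m invmx W *m A) *m invmx B =
  invmx B *m (1%:M + (E + G + G *m E)).
Proof.
move=> uB uW.
rewrite /A trmx_mul -!mulmxA (mulmxV uB) mulmx1; congr (_ *m _).
rewrite !mulmxA -[_ *m B^T]mulmxA -trmx_mul (mulmxV uB) trmx1 mulmx1.
have -> : (1%:M + E)^T = 1%:M + E^T by rewrite [LHS]linearD /= trmx1.
rewrite /G !(mulmxDl, mulmxDr, mulmx1, mul1mx) (mulmxV uW) mul1mx.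
by rewrite -!addrA; congr (_ + _); rewrite addrCA.
Qed.

Theorem theorem2p1 (R : realType) (n : nat) (A At W : 'M[R]_n)
    (hA : A \in unitmx) (hAt : At \in unitmx) (hW : sym_posdef W) :
  let Ap := (invmx At *m W *m (invmx At)^T) *m (A^T *m invmx W *m A) in
  let E := A *m invmx At - 1%:M in
  spectrum Ap `<=`
    cball 1 ((1 + cond2 W) * norm2 E + cond2 W * norm2 E ^+ 2).
Proof.
move=> Ap E z /eigenvalueP[v vAp v0].
have uW := sym_posdef_unitmx hW; have [WT _] := hW.
have AE : A = (1%:M + E) *m At by rewrite addrC subrK mulmxKV.
clearbody E; pose G := W *m E^T *m invmx W.
pose F := E + G + G *m E.
have ApE : Ap *m invmx At = invmx At *m (1%:M + F).
  by rewrite /Ap AE preconditioned_mulmx_inv.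
have := norm2_ge0 E; have := norm2_ge0 W; have := norm2_ge0 (invmx W).
set e := norm2 E; set w := norm2 W; set w' := norm2 (invmx W) => w'0 w0 e0.
(* Since [W] is symmetric, [G^T = W^-1 E W], and the three factors contribute [w'], [e] and [w]. *)
have GT x : euclidean_norm (G^T *m x) <= cond2 W * e * euclidean_norm x.
  rewrite /G !trmx_mul trmxK WT trmx_inv WT -!mulmxA.
  apply: le_trans (euclidean_norm_mulmx _ _) _.
  rewrite /cond2 -/w -/w' [w * w']mulrC -!mulrA ler_wpM2l //.
  rewrite [w * (e * _)]mulrCA.
  apply: le_trans (euclidean_norm_mulmx _ _) _; rewrite ler_wpM2l //.
  exact: euclidean_norm_mulmx.
clearbody G; have c0 : 0 <= cond2 W by rewrite mulr_ge0.
set r := (X in cball _ X).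
change (`|1 - z| <= real_complex R r); rewrite distrC.
(* The row [v *m invmx At] is an eigenvector of [F] for [z - 1]; it is nonzero because multiplying
   it by [At] gives back [v]. *)
apply: (@eigenvalue_norm_le _ _ F r (v *m map_mx (real_complex R) (invmx At))).
- by rewrite /r addr_ge0 ?mulr_ge0 ?addr_ge0 ?exprn_ge0.
(* The terms [E^T x], [G^T x] and [E^T (G^T x)] have norms at most [e], [cond2 W * e] and
   [cond2 W * e ^+ 2] times [|x|]; these coefficients add up to [r]. *)
- move=> x; rewrite /r /F !linearD /= trmx_mul !mulmxDl -mulmxA.
  apply: le_trans (euclidean_normD _ _) _.
  apply: le_trans (lerD (euclidean_normD _ _) (lexx _)) _.
  have := euclidean_norm_mul_trmx E x; have := GT x.
  have : euclidean_norm (E^T *m (G^T *m x)) <= e * (cond2 W * e * euclidean_norm x).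
    by apply: le_trans (euclidean_norm_mul_trmx _ _) _; rewrite ler_wpM2l.
  rewrite -/e; lra.
- apply: contra v0 => /eqP /(congr1 (mulmx^~ (map_mx (real_complex R) At))).
  by rewrite -mulmxA -map_mxM mulVmx // map_mx1 mulmx1 mul0mx => ->.
- have := congr1 (mulmx^~ (map_mx (real_complex R) (invmx At))) vAp.
  rewrite -mulmxA -map_mxM ApE map_mxM map_mxD map_mx1 mulmxA mulmxDr mulmx1.
  by rewrite -scalemxAl scalerBl scale1r => <-; rewrite addrC addKr.
Qed.
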